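(* Let $q$ be a power of a prime $p$ and let $e,k$ be nontrivial divisors of $q-1$ such that $q=ek+1$. Let $a,b\in\{1,\dots,e-1\}$ with $a\ne b$. If $$p>\left(\frac{14k}{\varphi(k)}\right)^{\frac{\varphi(k)}{2\operatorname{ord}_k(p)}},$$ then the cyclotomic number $(a,b)$ of order $e$ over $\mathbb{F}_q$ satisfies $(a,b)\le 2$.
   Context: A nontrivial divisor of $q-1$ is a divisor different from $1$ and $q-1$. $\operatorname{ord}_k(p)$ is the multiplicative order of $p$ modulo $k$ and $\varphi$ is Euler's totient function. Fix a primitive element $g$ of the finite field $\mathbb{F}_q$. For $a\in\mathbb{Z}$ let $C_a=\{g^a,g^{a+e},\dots,g^{a+(k-1)e}\}$, so that $C_a=C_{a+e}$. The cyclotomic number $(a,b)$ of order $e$ is the number of solutions of $1+x=y$ with $x\in C_a$, $y\in C_b$; equivalently, the number of pairs of integers $(r,s)$ with $0\le r,s\le k-1$ and $1+g^{a+re}=g^{b+se}$. *)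

(* Defs.v *)
From HB Require Import structures.
From mathcomp Require Import all_boot all_order all_algebra.
From mathcomp Require Import all_fingroup all_solvable.
From mathcomp Require Import reals exp.

Set Implicit Arguments.
Unset Strict Implicit.
Unset Printing Implicit Defensive.

Import Order.TTheory GRing.Theory Num.Theory.
Local Open Scope ring_scope.

Definition nontrivial_divisor (d m : nat) : bool :=
  [&& d %| m, d != 1 & d != m]%N.

(* The order of the class of p in the unit group of Z/k.  This is meaningful
   only for 1 < k and p coprime to k; when p is not a unit of 'Z_k, insubd
   returns the group identity and the value is 1. *)
Definition ord_mod (k p : nat) : nat :=
  #[insubd (1%g : {unit 'Z_k}) (p%:R : 'Z_k)]%g.

Section Cyclotomy.
Variables (F : finFieldType) (g : {unit F}) (e k : nat).

Definition primitive_element : bool := generator [set: {unit F}] g.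

Definition cyclotomic_class (a : int) : {set F} :=
  [set FinRing.uval g ^ (a + (nat_of_ord r)%:Z * e%:Z) | r : 'I_k].

Definition cyclotomic_number (a b : int) : nat :=
  #|[set xy : F * F | [&& xy.1 \in cyclotomic_class a,
                          xy.2 \in cyclotomic_class b & 1 + xy.1 == xy.2]]|.

End Cyclotomy.

(* Main.v *)
Require Import Defs.
From HB Require Import structures.
From mathcomp Require Import all_boot all_order all_algebra.
From mathcomp Require Import all_fingroup all_solvable all_field.
From mathcomp Require Import reals exp.
From mathcomp Require Import ring lra zify.

Set Implicit Arguments.
Unset Strict Implicit.
Unset Printing Implicit Defensive.

Import Order.TTheory GRing.Theory Num.Theory.
Local Open Scope ring_scope.

(** Put w = g^e, a primitive k-th root of unity of F, and suppose that there
    are three solutions 1 + g^a w^(r_i) = g^b w^(s_i).  Then the three points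
    (u_i, v_i) = (w^(r_i), w^(s_i)) lie on one line, so the determinant [area]
    with rows (1, u_i, v_i) vanishes.  This determinant is a signed sum of six
    powers of w, three with sign + and three with sign -.  The proof lifts this
    vanishing sum to characteristic 0, where it cannot occur.

    Impossibility in characteristic 0 ([collinear_with_inverses]): complex
    conjugation inverts roots of unity, so the determinant of the inverses
    vanishes too, and the two equations force two of the points to share a
    coordinate or the ratio u/v.  Such a coincidence only depends on exponents
    modulo k, hence also holds in F; there, as g^b v_i = 1 + g^a u_i, it makes
    two of the three solutions equal.

    Lifting ([lift_vanishing_sum]): let P be an integer polynomial with
    P(w) = 0, z a primitive k-th root of unity in algC, and N the product of
    the P(z^j) over j prime to k, which is the norm of P(z).
    - p^f divides N, where f = ord_k(p).  Indeed N is the determinant of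
      multiplication by P on Z[X]/(Phi_k); over F this endomorphism is
      diagonalisable with eigenvalues P(w^j), and those with j = p^i, i < f,
      vanish by Frobenius.  So the rank modulo p is at most phi(k) - f, and
      the Smith normal form has at least f diagonal entries divisible by p
      ([dvdz_exp_det_rank], [cyclotomic_norm_dvd], [leq_ord_mod_roots]).
    - N^2 <= (C k / phi(k))^phi(k) if C bounds the sum of the squares of the
      coefficients of P reduced modulo X^k - 1.  This is the inequality between
      arithmetic and geometric means for the |P(z^j)|^2 with j prime to k: their
      sum is at most the sum over all j modulo k, which Parseval's identity
      evaluates ([Parseval_sparse]).
    If p^(2f) exceeds this bound, N = 0, so P vanishes at some z^j.

    For the determinant, C = 14 = 9 + 5 is correct unless the three positive
    exponents are congruent modulo k and so are the three negative ones
    ([energy_area_le14]).  In that exceptional case the determinant is 3 times a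
    difference, and a direct computation in F concludes
    ([cyclic_ratio_char3]). *)

(** * Rank modulo p and divisibility of determinants *)

Section DiagRank.
Variables (K : fieldType) (m : nat).

(** The matrix factors through a space whose dimension is the number of nonzero
    diagonal entries. *)
Lemma rank_diag_mx_le (d : 'rV[K]_m) :
  (\rank (diag_mx d) <= #|[set i | d 0%R i != 0%R]|)%N.
Proof.
set S := [set i | d 0 i != 0].
have -> : diag_mx d = colsub (fun i : 'I_#|S| => enum_val i) (diag_mx d)
                        *m rowsub (fun i : 'I_#|S| => enum_val i) 1%:M.
  apply/matrixP=> i j; rewrite !mxE.
  under eq_bigr do rewrite !mxE.
  have [iS|/negbTE iS] := boolP (i \in S).
    rewrite (bigD1 (enum_rank_in iS i)) //= enum_rankK_in // eqxx mulr1n.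
    rewrite big1 ?addr0 => [|l li]; first by rewrite mulr_natr.
    rewrite (_ : (i == enum_val l) = false) ?mulr0n ?mul0r //.
    by apply: contraNF li => /eqP il; rewrite -(inj_eq enum_val_inj) enum_rankK_in // il.
  have /eqP-> : d 0 i == 0 by move: iS; rewrite inE => /negbFE.
  rewrite mul0rn big1 // => l _.
  rewrite (_ : (i == enum_val l) = false) ?mulr0n ?mul0r //.
  by apply: contraFF iS => /eqP->; apply: enum_valP.
exact: mulmx_max_rank.
Qed.

(** Adding a diagonal matrix supported on the zero entries makes [diag_mx d]
    invertible, so the upper bounds on the two ranks must both be attained. *)
Lemma rank_diag_mx (d : 'rV[K]_m) :
  \rank (diag_mx d) = #|[set i | d 0 i != 0%R]|.
Proof.
apply/eqP; rewrite eqn_leq rank_diag_mx_le /=.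
pose d' : 'rV[K]_m := \row_i (d 0 i == 0)%:R.
have rk_sum : \rank (diag_mx d + diag_mx d')%R = m.
  apply: mxrank_unit; rewrite -raddfD unitmxE det_diag unitfE.
  apply/prodf_neq0 => i _; rewrite !mxE.
  by have [->|di] := eqVneq (d 0 i) 0; rewrite ?add0r ?oner_eq0 ?addr0.
have := mxrank_add (diag_mx d) (diag_mx d'); rewrite rk_sum => le_m.
have := rank_diag_mx_le d'.
have -> : [set i | d' 0 i != 0] = ~: [set i | d 0 i != 0].
  apply/setP=> i; rewrite !inE mxE negbK.
  by case: (d 0 i == 0); rewrite ?oner_eq0 ?eqxx.
have := cardsC [set i | d 0 i != 0]; rewrite card_ord.
move: #|_| #|_| (\rank _) (\rank _) le_m => x y s t; lia.
Qed.

End DiagRank.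

(** The Smith normal form is M up to unimodular factors: the rank over K counts
    its diagonal entries prime to p, and each of the others contributes a
    factor p to the determinant. *)
Lemma dvdz_exp_det_rank (K : fieldType) (p m : nat) (M : 'M[int]_m) :
  p \in [pchar K] ->
  (p%:Z ^+ (m - \rank (map_mx (intr : int -> K) M)) %| \det M)%Z.
Proof.
move=> charKp.
have [L unitL [R unitR [d _ ->]]] := int_Smith_normal_form M.
set c := \row_(i < m) d`_i.
have -> : (\matrix_(i, j) (d`_i *+ (i == j)) : 'M[int]_m) = diag_mx c.
  by apply/matrixP => i j; rewrite !mxE.
have rk : \rank (map_mx (intr : int -> K) (L *m diag_mx c *m R))
          = #|[set i | ~~ (p %| c 0%R i)%Z]|.
  have unit_map (A : 'M[int]_m) : A \in unitmx -> map_mx (intr : int -> K) A \in unitmx.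
    by move=> uA; rewrite unitmxE det_map_mx rmorph_unit // -unitmxE.
  rewrite !map_mxM /= mxrankMfree ?row_free_unit ?unit_map //.
  rewrite (eqmxMfull _ _) ?row_full_unit ?unit_map // map_diag_mx rank_diag_mx.
  by apply: eq_card => i; rewrite !inE !mxE -(dvdz_pcharf charKp).
have -> : (m - \rank (map_mx (intr : int -> K) (L *m diag_mx c *m R)) =
          #|[set i | (p %| c 0%R i)%Z]|)%N.
  have := cardsC [set i | (p %| c 0%R i)%Z]; rewrite rk card_ord.
  rewrite (_ : ~: _ = [set i | ~~ (p %| c 0%R i)%Z]).
    by move: #|_| #|_| => x y; lia.
  by apply/setP=> i; rewrite !inE.
rewrite !det_mulmx mulrAC dvdz_mull // det_diag.
rewrite (bigID (mem [set i | (p %| c 0%R i)%Z])) /= dvdz_mulr //.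
rewrite -prodr_const; elim/big_rec2: _ => [|i x y]; first exact: dvdzz.
by rewrite inE => pc xy; apply: dvdz_mul.
Qed.

(** * The norm from the cyclotomic field, as a determinant *)

(** In any characteristic: w is a root of X^k - 1, the product of the Phi_d with
    d dividing k, and the order of a root of Phi_d divides d. *)
Lemma root_Cyclotomic (K : fieldType) (k : nat) (w : K) :
  k.-primitive_root w -> root (map_poly intr 'Phi_k) w.
Proof.
move=> prim_w; have k_gt0 := prim_order_gt0 prim_w.
have prodE n : (0 < n)%N ->
    \prod_(d <- divisors n) (map_poly (intr : int -> K) 'Phi_d).[w] = w ^+ n - 1.
  move=> n_gt0; rewrite -horner_prod -rmorph_prod prod_Cyclotomic //.
  by rewrite rmorphB /= rmorph1 map_polyXn !hornerE.
have /eqP := prodE k k_gt0; rewrite (prim_expr_order prim_w) subrr.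
rewrite prodf_seq_eq0 => /hasP[d d_k /= Phi_d_w].
have d_gt0 : (0 < d)%N by rewrite (dvdn_gt0 k_gt0) ?dvdn_divisors.
have : w ^+ d == 1.
  rewrite -subr_eq0 -prodE // prodf_seq_eq0; apply/hasP.
  by exists d; rewrite -?dvdn_divisors.
rewrite -(prim_order_dvd prim_w) => kd.
have -> : k = d by apply/eqP; rewrite eqn_dvd kd dvdn_divisors.
exact: Phi_d_w.
Qed.

(** The matrix of multiplication by P on Z[X]/(Phi), in the basis of the powers
    of X and acting on row vectors. *)
Definition mulmod_mx (m : nat) (Phi P : {poly int}) : 'M[int]_m :=
  \matrix_(i, j) (Pdiv.Ring.rmodp ('X^i * P) Phi)`_j.

Section MulMod.
Variables (K : fieldType) (m : nat) (Phi P : {poly int}) (w : 'I_m -> K).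
Hypotheses (Phi_monic : Phi \is monic) (size_Phi : size Phi = m.+1).
Hypotheses (Phi_w : forall j, root (map_poly intr Phi) (w j)) (w_inj : injective w).

Let ev (Q : {poly int}) j : K := (map_poly intr Q).[w j].
Let V := Vandermonde m (\row_j w j).

Lemma Vandermonde_unitmx : V \in unitmx.
Proof.
rewrite unitmxE det_Vandermonde unitfE; apply/prodf_neq0 => i _.
apply/prodf_neq0 => j ij; rewrite !mxE subr_eq0 (inj_eq w_inj).
by apply: contraTneq ij => ->; rewrite ltnn.
Qed.

(** Evaluation at the roots of Phi turns multiplication by P modulo Phi into
    pointwise multiplication, so the Vandermonde matrix diagonalises it. *)
Lemma mulmod_mx_Vandermonde :
  map_mx intr (mulmod_mx m Phi P) *m V = V *m diag_mx (\row_j ev P j).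
Proof.
apply/matrixP => i j; rewrite mul_mx_diag !mxE.
set Q := Pdiv.Ring.rmodp ('X^i * P) Phi.
have -> : w j ^+ i * ev P j = ev Q j.
  have := congr1 (fun A => ev A j) (Pdiv.RingMonic.rdivp_eq Phi_monic ('X^i * P)).
  rewrite /ev !rmorphD !rmorphM /= map_polyXn !hornerE.
  by rewrite (eqP (Phi_w j)) mulr0 add0r.
rewrite /ev (@horner_coef_wide _ m); last first.
  rewrite (leq_trans (size_poly _ _)) // -ltnS -size_Phi.
  by rewrite Pdiv.Ring.ltn_rmodp monic_neq0.
by apply: eq_bigr => l _; rewrite !mxE coef_map.
Qed.

Lemma det_mulmod_mx :
  (\det (mulmod_mx m Phi P))%:~R = \prod_j (map_poly intr P).[w j].
Proof.
have := congr1 determinant mulmod_mx_Vandermonde.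
rewrite !det_mulmx det_diag det_map_mx mulrC => /mulrI -> //.
  by apply: eq_bigr => j _; rewrite mxE.
by rewrite -unitmxE Vandermonde_unitmx.
Qed.

Lemma rank_mulmod_mx :
  \rank (map_mx (intr : int -> K) (mulmod_mx m Phi P)) =
  #|[set j | (map_poly intr P).[w j] != 0]|.
Proof.
have rfV : row_free V by rewrite row_free_unit Vandermonde_unitmx.
rewrite -(mxrankMfree _ rfV) mulmod_mx_Vandermonde.
rewrite (eqmxMfull _ _) ?row_full_unit ?Vandermonde_unitmx // rank_diag_mx.
by apply: eq_card => j; rewrite !inE mxE.
Qed.

End MulMod.

Section CyclotomicNorm.
Variables (k : nat) (k_gt1 : (1 < k)%N).
Local Notation U := {unit 'Z_k}.

Lemma unit_Zp_lt (u : U) : (val u < k)%N.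
Proof. by rewrite -[X in (_ < X)%N](Zp_cast k_gt1). Qed.

Lemma coprime_unit_Zp (u : U) : coprime (val u) k.
Proof.
have := valP u; rewrite -[X in X \in _]natr_Zp unitZpE //.
by rewrite coprime_sym.
Qed.

Lemma prim_root_unit_exp (K : fieldType) (w : K) (u : U) :
  k.-primitive_root w -> k.-primitive_root (w ^+ val u).
Proof. by move=> prim_w; rewrite prim_root_exp_coprime ?coprime_unit_Zp. Qed.

Lemma prim_root_unit_inj (K : fieldType) (w : K) :
  k.-primitive_root w -> injective (fun u : U => w ^+ val u).
Proof.
move=> prim_w u v /eqP; rewrite (eq_prim_root_expr prim_w).
by rewrite !modn_small ?unit_Zp_lt // => /eqP uv; do 2!apply: val_inj.
Qed.

(** One integer matrix is diagonalised both over algC, where its determinant is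
    the norm of P(z), and over K, where its corank counts the conjugates of w
    killed by P. *)
Lemma cyclotomic_norm_dvd (K : fieldType) (p : nat) (w : K) (z : algC)
    (P : {poly int}) :
  p \in [pchar K] -> k.-primitive_root w -> k.-primitive_root z ->
  exists2 N : int,
    N%:~R = \prod_(u : U) (map_poly intr P).[z ^+ val u] &
    (p%:Z ^+ #|[set u : U | (map_poly intr P).[w ^+ val u] == 0%R]| %| N)%Z.
Proof.
move=> charKp prim_w prim_z.
pose e (i : 'I_#|{: U}|) : nat := val (enum_val i : U).
have size_Phi : size 'Phi_k = #|{: U}|.+1.
  by rewrite size_Cyclotomic -card_units_Zp 1?ltnW // cardsT.
have root_Phi (L : fieldType) (x : L) i :
    k.-primitive_root x -> root (map_poly intr 'Phi_k) (x ^+ e i).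
  by move=> prim_x; apply/root_Cyclotomic/prim_root_unit_exp.
have inj_e (L : fieldType) (x : L) :
    k.-primitive_root x -> injective (fun i => x ^+ e i).
  by move=> prim_x i j /(prim_root_unit_inj prim_x)/enum_val_inj.
exists (\det (mulmod_mx #|{: U}| 'Phi_k P)).
  rewrite (det_mulmod_mx P (Cyclotomic_monic k) size_Phi
    (fun i => root_Phi _ _ i prim_z) (inj_e _ _ prim_z)).
  by rewrite [RHS](reindex _ (onW_bij _ (enum_val_bij _))).
have := dvdz_exp_det_rank (mulmod_mx #|{: U}| 'Phi_k P) charKp.
rewrite (rank_mulmod_mx P (Cyclotomic_monic k) size_Phi
    (fun i => root_Phi _ _ i prim_w) (inj_e _ _ prim_w)).
congr (_ ^+ _ %| _)%Z.
set S := [set u | _ == 0]; have cS := cardsC S.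
have := on_card_preimset (R := ~: S) (onW_bij _ (enum_val_bij _)).
rewrite (_ : _ @^-1: _ = [set j : 'I_#|{: U}| | (map_poly intr P).[w ^+ e j] != 0]).
  by move: cS => /(congr1 (subn^~ #|~: S|)); rewrite addnK => -> <-.
by apply/setP => i; rewrite !inE.
Qed.

End CyclotomicNorm.

(** * Zeros of integer polynomials along Frobenius orbits *)

Lemma horner_int_Frobenius (K : fieldType) (p : nat) (P : {poly int}) (x : K) i :
  p \in [pchar K] -> root (map_poly intr P) x ->
  root (map_poly intr P) (x ^+ (p ^ i)).
Proof.
move=> charKp /eqP Px; elim: i => [|i /eqP IHi]; first by rewrite expr1; apply/eqP.
have FrobP : map_poly (pFrobenius_aut charKp) (map_poly intr P) = map_poly intr P.
  by apply/polyP => j; rewrite !coef_map /= rmorph_int.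
rewrite expnSr exprM -(pFrobenius_autE charKp) -FrobP; apply/eqP.
by rewrite horner_map IHi rmorph0.
Qed.

(** Every element of the subgroup generated by p in the units of Z/k gives a
    zero, since Frobenius maps zeros to zeros. *)
Lemma leq_ord_mod_roots (k p : nat) (k_gt1 : (1 < k)%N) (K : fieldType) (w : K)
    (P : {poly int}) :
  p \in [pchar K] -> k.-primitive_root w -> coprime k p ->
  root (map_poly intr P) w ->
  (ord_mod k p <= #|[set u : {unit 'Z_k} | (map_poly intr P).[w ^+ val u] == 0%R]|)%N.
Proof.
move=> charKp prim_w co_kp Pw; rewrite /ord_mod /order; set x := insubd _ _.
have val_x : val x = p%:R by rewrite insubdK // unitZpE.
apply/subset_leq_card/subsetP => _ /cycleP[i ->]; rewrite inE.
have -> : w ^+ val (x ^+ i)%g = w ^+ (p ^ i).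
  have -> : val (x ^+ i)%g = (p ^ i)%:R :> 'Z_k.
    by rewrite natrX -val_x; elim: i => //= i IHi; rewrite expgS /= IHi exprS.
  by rewrite val_Zp_nat // (prim_expr_mod prim_w).
exact: horner_int_Frobenius.
Qed.

(** * Parseval's identity for sums of roots of unity *)

Lemma sum_unity_root_powers (K : fieldType) (k : nat) (y : K) :
  y ^+ k = 1 -> \sum_(j < k) y ^+ j = if y == 1 then k%:R else 0.
Proof.
move=> yk; have [->|y_neq1] := eqVneq y 1.
  under eq_bigr do rewrite expr1n.
  by rewrite sumr_const card_ord.
apply: (@mulfI _ (y - 1)); first by rewrite subr_eq0.
by rewrite -subrX1 yk subrr mulr0.
Qed.

Lemma prim_root_neq0 (K : fieldType) (k : nat) (z : K) :
  k.-primitive_root z -> z != 0.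
Proof.
move=> prim_z; apply: contra_eq_neq (prim_expr_order prim_z) => ->.
by rewrite expr0n gtn_eqF ?(prim_order_gt0 prim_z) // eq_sym oner_eq0.
Qed.

Lemma conjC_prim_root (k : nat) (z : algC) : k.-primitive_root z -> z^* = z^-1.
Proof.
move=> prim_z; have k_gt0 := prim_order_gt0 prim_z.
have norm_z : `|z| = 1.
  apply/eqP; rewrite -(@pexpr_eq1 _ _ k) //.
  by rewrite -normrX (prim_expr_order prim_z) normr1.
have z_neq0 : z != 0 by rewrite -normr_eq0 norm_z oner_eq0.
by apply: (mulfI z_neq0); rewrite -normCK norm_z expr1n mulfV.
Qed.

Section SparseSum.
Variables (I : finType) (s : I -> int) (n : I -> nat).

Definition sparse_eval (K : nzRingType) (x : K) : K := \sum_t (s t)%:~R * x ^+ n t.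

Definition sparse_poly : {poly int} := \sum_t s t *: 'X^(n t).

(** The sum of the squares of the coefficients of [sparse_poly] reduced modulo
    X^k - 1, written as a double sum so that colliding exponents need not be
    collected. *)
Definition energy (k : nat) : int :=
  \sum_t \sum_t' s t * s t' * (n t == n t' %[mod k])%N%:R.

Lemma horner_sparse_poly (K : comNzRingType) (x : K) :
  (map_poly intr sparse_poly).[x] = sparse_eval x.
Proof.
rewrite raddf_sum horner_sum; apply: eq_bigr => t _ /=.
by rewrite map_polyZ map_polyXn !hornerE.
Qed.

Lemma conjC_sparse_eval (z : algC) : (sparse_eval z)^* = sparse_eval (z^*).
Proof.
rewrite rmorph_sum; apply: eq_bigr => t _.
by rewrite rmorphM rmorph_int rmorphXn.
Qed.

(** Once the squared modulus is expanded, orthogonality of the characters of Z/k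
    keeps the pairs of terms with congruent exponents. *)
Lemma Parseval_sparse (k : nat) (z : algC) : k.-primitive_root z ->
  \sum_(j < k) `|sparse_eval (z ^+ j)| ^+ 2 = k%:R * (energy k)%:~R.
Proof.
move=> prim_z; have conj_z := conjC_prim_root prim_z.
have z_neq0 := prim_root_neq0 prim_z.
have expand (j : 'I_k) : `|sparse_eval (z ^+ j)| ^+ 2 =
    \sum_t \sum_t' (s t)%:~R * (s t')%:~R * (z ^+ n t / z ^+ n t') ^+ j.
  rewrite normCK conjC_sparse_eval mulr_suml; apply: eq_bigr => t _.
  rewrite mulr_sumr; apply: eq_bigr => t' _.
  rewrite rmorphXn /= conj_z mulrACA; congr (_ * _).
  by rewrite exprMn !exprVn -!exprM mulnC (mulnC j).
under eq_bigr do rewrite expand.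
rewrite exchange_big /energy rmorph_sum mulr_sumr; apply: eq_bigr => t _ /=.
rewrite exchange_big rmorph_sum mulr_sumr; apply: eq_bigr => t' _ /=.
rewrite -mulr_sumr sum_unity_root_powers; last first.
  rewrite expr_div_n -!exprM !(mulnC _ k) !exprM (prim_expr_order prim_z).
  by rewrite !expr1n divr1.
rewrite -(inj_eq (mulIf (expf_neq0 (n t') z_neq0))) mulfVK ?expf_neq0 // mul1r.
rewrite (eq_prim_root_expr prim_z) !rmorphM /=.
by case: eqP; rewrite ?rmorph1 ?rmorph0 ?mulr1 ?mulr0 // mulrC.
Qed.

End SparseSum.

(** * Lifting vanishing sums to characteristic zero *)

Section Lift.
Variables (k : nat) (k_gt1 : (1 < k)%N).
Local Notation U := {unit 'Z_k}.

Lemma sum_unit_Zp_le (f : nat -> algC) : (forall j, 0 <= f j) ->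
  \sum_(u : U) f (val u) <= \sum_(j < k) f j.
Proof.
move=> f_ge0.
pose h (u : U) : 'I_k := Ordinal (unit_Zp_lt k_gt1 u).
have h_inj : injective h by move=> u v [] /val_inj/val_inj.
have -> : \sum_(u : U) f (val u) = \sum_(j in h @: [set: U]) f j.
  rewrite big_imset => [|u v _ _]; last exact: h_inj.
  by apply: eq_bigl => u; rewrite inE.
rewrite [leRHS](bigID (mem (h @: [set: U]))) /=.
by rewrite lerDl sumr_ge0.
Qed.

(** The norm N of the sum is divisible by p^f with f = ord_k(p), while the
    arithmetic-geometric mean inequality and Parseval's identity bound N^2 by
    (C k / phi(k))^phi(k); so N = 0, and a conjugate of the sum vanishes. *)
Theorem lift_vanishing_sum (K : fieldType) (p C : nat) (w : K)
    (I : finType) (s : I -> int) (n : I -> nat) :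
  p \in [pchar K] -> k.-primitive_root w -> coprime k p ->
  (energy s n k <= C%:Z)%R ->
  ((C * k) ^ totient k < p ^ (2 * ord_mod k p) * totient k ^ totient k)%N ->
  sparse_eval s n w = 0 ->
  exists2 z : algC, k.-primitive_root z & sparse_eval s n z = 0.
Proof.
move=> charKp prim_w co_kp le_C p_large sw0.
have [z prim_z] := C_prim_root_exists (ltnW k_gt1).
have [N N_prod N_dvd] := cyclotomic_norm_dvd k_gt1 (sparse_poly s n) charKp prim_w prim_z.
set m := totient k in p_large; set f := ord_mod k p in p_large.
have cardU : #|{: U}| = m by rewrite /m -card_units_Zp 1?ltnW // cardsT.
have m_gt0 : (0 < m)%N by rewrite totient_gt0 ltnW.
have {}N_dvd : (p%:Z ^+ f %| N)%Z.
  apply: dvdz_trans N_dvd; apply: dvdz_exp2l.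
  by apply: leq_ord_mod_roots => //; rewrite rootE horner_sparse_poly sw0.
have [N0|N_neq0] := eqVneq N 0.
  have /eqP : \prod_(u : U) (map_poly intr (sparse_poly s n)).[z ^+ val u] = 0.
    by rewrite -N_prod N0.
  rewrite prodf_seq_eq0 => /hasP[u _ /eqP Pu]; exists (z ^+ val u).
    exact: prim_root_unit_exp.
  by rewrite -horner_sparse_poly.
move: p_large; rewrite ltnNge => /negP[].
have p_le_N : (p ^ f <= `|N|)%N.
  by rewrite dvdn_leq ?absz_gt0 //; move: N_dvd; rewrite dvdzE abszX.
have N2_le : (`|N| ^ 2 * m ^ m <= (C * k) ^ m)%N.
  rewrite -(ler_nat algC) natrM !natrX.
  have -> : `|N|%:R ^+ 2 = \prod_(u : U) `|sparse_eval s n (z ^+ val u)| ^+ 2 :> algC.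
    rewrite natr_absz intr_norm N_prod normr_prod prodrXl.
    by congr (_ ^+ 2); apply: eq_bigr => u _; rewrite horner_sparse_poly.
  have [AGM _] := leif_AGM (F := algC) (A := {: U})
    (E := fun u => `|sparse_eval s n (z ^+ val u)| ^+ 2) (fun u _ => exprn_ge0 _ (normr_ge0 _)).
  rewrite cardU in AGM.
  rewrite -ler_pdivlMr ?exprn_gt0 ?ltr0n // -expr_div_n.
  apply: le_trans AGM _; apply: lerXn2r.
  - by rewrite nnegrE divr_ge0 ?sumr_ge0 // => u _; rewrite exprn_ge0.
  - by rewrite nnegrE divr_ge0.
  rewrite ler_pM2r ?invr_gt0 ?ltr0n //.
  have le_k := sum_unit_Zp_le (f := fun j => `|sparse_eval s n (z ^+ j)| ^+ 2)
    (fun j => exprn_ge0 _ (normr_ge0 _)).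
  apply: le_trans le_k _.
  rewrite Parseval_sparse // natrM mulrC ler_pM2r ?ltr0n ?(ltnW k_gt1) //.
  by rewrite -[C%:R]/(C%:Z%:~R) ler_int.
by apply: leq_trans N2_le; rewrite leq_mul2r mulnC expnM leq_sqr p_le_N orbT.
Qed.

End Lift.

(** * Collinear triples of points *)

(** The determinant with rows (1, u_i, v_i), expanded. *)
Definition area (K : nzRingType) (u1 u2 u3 v1 v2 v3 : K) : K :=
  u1 * v2 + u2 * v3 + u3 * v1 - u2 * v1 - u3 * v2 - u1 * v3.

(** With A = (u2 - u1)(v3 - v1) and B = (u3 - u1)(v2 - v1), the area is A - B, and
    clearing denominators in the area of the inverses gives
    A u3 v2 - B u2 v3.  When both vanish, A (u2 v3 - u3 v2) = 0. *)
Lemma collinear_with_inverses (K : fieldType) (u1 u2 u3 v1 v2 v3 : K) :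
  [&& u1 != 0, u2 != 0, u3 != 0, v1 != 0, v2 != 0 & v3 != 0] ->
  area u1 u2 u3 v1 v2 v3 = 0 ->
  area u1^-1 u2^-1 u3^-1 v1^-1 v2^-1 v3^-1 = 0 ->
  [|| u1 == u2, v1 == v3 | u2 * v3 == u3 * v2].
Proof.
case/and5P=> u1n u2n u3n v1n /andP[v2n v3n] area0 area_inv0.
rewrite -(subr_eq0 u1) -(subr_eq0 v1) -(subr_eq0 (u2 * v3)) -!mulf_eq0.
have -> : (u1 - u2) * ((v1 - v3) * (u2 * v3 - u3 * v2)) =
    u2 * v3 * area u1 u2 u3 v1 v2 v3
    - u1 * u2 * u3 * v1 * v2 * v3 * area u1^-1 u2^-1 u3^-1 v1^-1 v2^-1 v3^-1.
  by rewrite /area; field; rewrite u1n u2n u3n v1n v2n v3n.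
by rewrite area0 area_inv0 !mulr0 subrr.
Qed.

(** The area is here 3 (u1 v2 - u2 v1).  In characteristic 3 the hypotheses give
    v1 v2 = v3^2 and v2 v3 = v1^2, hence v1^3 = v3^3, and cubing is injective. *)
Lemma cyclic_ratio_char3 (K : fieldType) (u1 u2 u3 v1 v2 v3 : K) :
  [&& u1 != 0, u2 != 0 & u3 != 0] ->
  u1 * v2 = u2 * v3 -> u2 * v3 = u3 * v1 ->
  u2 * v1 = u3 * v2 -> u3 * v2 = u1 * v3 ->
  area u1 u2 u3 v1 v2 v3 = 0 -> u1 * v2 = u2 * v1 \/ v1 = v3.
Proof.
case/and3P=> u1n u2n u3n e1 e2 e3 e4 area0.
have /eqP : 3%:R * (u1 * v2 - u2 * v1) = 0.
  by rewrite -area0 /area -e4 -e3 -e2 -e1; ring.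
rewrite mulf_eq0 subr_eq0 => /orP[/eqP three0|/eqP]; last by left.
right; have v3sq : v2 * v1 = v3 * v3.
  by apply: (mulfI (mulf_neq0 u1n u2n)); rewrite mulrACA e3 e1 e4; ring.
have v1sq : v3 * v2 = v1 * v1.
  by apply: (mulfI (mulf_neq0 u2n u3n)); rewrite mulrACA e2 -e3; ring.
suff /eqP : (v1 - v3) ^+ 3 = 0 by rewrite expf_eq0 subr_eq0 => /eqP.
have -> : (v1 - v3) ^+ 3 = v1 * (v1 * v1) - v3 * (v3 * v3) - 3%:R * (v1 * v3 * (v1 - v3)).
  by ring.
by rewrite three0 mul0r subr0 -v1sq -v3sq; ring.
Qed.

Definition area_sign (t : 'I_6) : int := (-1) ^+ (2 < t)%N.

(** The exponents are listed with the three positive monomials of [area] first,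
    to match [area_sign]. *)
Definition area_exponent (r1 r2 r3 s1 s2 s3 : nat) (t : 'I_6) : nat :=
  nth 0%N [:: r1 + s2; r2 + s3; r3 + s1; r2 + s1; r3 + s2; r1 + s3]%N t.

Lemma sparse_eval_area (K : fieldType) (x : K) r1 r2 r3 s1 s2 s3 :
  sparse_eval area_sign (area_exponent r1 r2 r3 s1 s2 s3) x =
  area (x ^+ r1) (x ^+ r2) (x ^+ r3) (x ^+ s1) (x ^+ s2) (x ^+ s3).
Proof.
rewrite /sparse_eval !big_ord_recl big_ord0 /area_sign /area_exponent /= /area.
by rewrite !exprD /= !expr0 !expr1; ring.
Qed.

(** Pairs of terms of opposite signs contribute at most 0.  Three terms of the
    same sign contribute 9 if all their exponents are congruent, and at most
    5 otherwise; the hypothesis excludes 9 + 9. *)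
Lemma energy_area_le14 (k x1 x2 x3 y1 y2 y3 : nat) :
  ~~ [&& x1 == x2 %[mod k], x2 == x3 %[mod k], y1 == y2 %[mod k]
       & y2 == y3 %[mod k]]%N ->
  energy area_sign (nth 0%N [:: x1; x2; x3; y1; y2; y3]) k <= 14.
Proof.
rewrite /energy !big_ord_recl !big_ord0 /area_sign /= !expr0 !expr1.
rewrite ?mulN1r ?mulrN1 ?mul1r ?mulr1 ?opprK !eqxx.
move: (x1 %% k)%N (x2 %% k)%N (x3 %% k)%N (y1 %% k)%N (y2 %% k)%N (y3 %% k)%N.
move=> a b c d e f.
rewrite !(eq_sym d) !(eq_sym e) !(eq_sym f) (eq_sym c a) (eq_sym c b) (eq_sym b a).
have ge0 (h : bool) : 0 <= h%:R :> int by case: h.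
have triple (x y z : nat) :
    (x == y)%:R + (x == z)%:R + (y == z)%:R <= 1 + ((x == y) && (y == z))%:R * 2 :> int.
  have [->|xy] := eqVneq x y; first by case: (y == z).
  have [<-|_] := eqVneq x z; last by case: (y == z).
  by rewrite eq_sym (negbTE xy).
move=> not_const.
have not_both : (((a == b) && (b == c))%:R + ((d == e) && (e == f))%:R <= 1 :> int).
  by move: not_const; case: (a == b); case: (b == c); case: (d == e); case: (e == f).
move: not_both (triple a b c) (triple d e f).
move: (ge0 (a == d)) (ge0 (a == e)) (ge0 (a == f)) (ge0 (b == d)) (ge0 (b == e)).
move: (ge0 (b == f)) (ge0 (c == d)) (ge0 (c == e)) (ge0 (c == f)) => {ge0}.
rewrite /= !addr0 !mulr1n.
lra.
Qed.

(** * Three solutions cannot coexist *)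

(** Raising the hypothesis to the power 2 f clears the real exponent. *)
Lemma powR_bound_nat (R : realType) (p k f C m : nat) :
  (0 < f)%N -> (0 < m)%N ->
  (p%:R > ((C%:R * k%:R) / m%:R : R) `^ (m%:R / (2%:R * f%:R))) ->
  ((C * k) ^ m < p ^ (2 * f) * m ^ m)%N.
Proof.
move=> f_gt0 m_gt0 p_large.
have m_gt0R : 0 < m%:R :> R by rewrite ltr0n.
have base_ge0 : 0 <= C%:R * k%:R / m%:R :> R by rewrite divr_ge0 ?mulr_ge0.
have : ((C%:R * k%:R / m%:R : R) `^ (m%:R / (2%:R * f%:R))) ^+ (2 * f) < p%:R ^+ (2 * f).
  by rewrite ltrXn2r ?powR_ge0 // -lt0n muln_gt0.
rewrite -powR_mulrn ?powR_ge0 // -powRrM natrM divfK; last first.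
  by rewrite mulf_neq0 // ?pnatr_eq0 // -lt0n.
rewrite powR_mulrn // expr_div_n ltr_pdivrMr ?exprn_gt0 //.
by rewrite -natrM -!natrX -natrM ltr_nat.
Qed.

(** Whatever coincidence the lifted relation forces among the points with
    exponents (r_i, s_i) is a congruence of exponents modulo k, so it can be
    read in K, where the line 1 + A u = B v makes it identify two of them. *)
Lemma no_three_shifted_roots (K : fieldType) (p k : nat) (w A B : K)
    (r1 r2 r3 s1 s2 s3 : nat) :
  (1 < k)%N -> p \in [pchar K] -> coprime k p -> k.-primitive_root w ->
  ((14 * k) ^ totient k < p ^ (2 * ord_mod k p) * totient k ^ totient k)%N ->
  A != 0 -> B != 0 ->
  1 + A * w ^+ r1 = B * w ^+ s1 -> 1 + A * w ^+ r2 = B * w ^+ s2 ->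
  1 + A * w ^+ r3 = B * w ^+ s3 ->
  [|| w ^+ r1 == w ^+ r2, w ^+ r2 == w ^+ r3 | w ^+ r1 == w ^+ r3].
Proof.
move=> k_gt1 charKp co_kp prim_w p_large A0 B0 E1 E2 E3; apply/negPn/negP.
case/norP=> u12 /norP[u23 u13].
have w0 := prim_root_neq0 prim_w.
have areaw : area (w ^+ r1) (w ^+ r2) (w ^+ r3) (w ^+ s1) (w ^+ s2) (w ^+ s3) = 0.
  apply: (mulfI (mulf_neq0 A0 B0)); rewrite mulr0.
  transitivity (area (A * w ^+ r1) (A * w ^+ r2) (A * w ^+ r3)
                     (B * w ^+ s1) (B * w ^+ s2) (B * w ^+ s3)).
    by rewrite /area; ring.
  by rewrite -E1 -E2 -E3 /area; ring.
have v13 : w ^+ s1 != w ^+ s3.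
  apply: contra u13 => /eqP v13; apply/eqP/(mulfI A0)/(addrI 1).
  by rewrite E1 E3 v13.
(* The line misses the origin, so points on it with equal ratios coincide. *)
have ratio (i j s t : nat) : 1 + A * w ^+ i = B * w ^+ s -> 1 + A * w ^+ j = B * w ^+ t ->
    w ^+ i * w ^+ t = w ^+ j * w ^+ s -> w ^+ i = w ^+ j.
  move=> Ei Ej eq_ij; apply: (mulfI A0).
  have : A * w ^+ i * (B * w ^+ t) = A * w ^+ j * (B * w ^+ s).
    by rewrite mulrACA eq_ij; ring.
  rewrite -Ei -Ej !mulrDr !mulr1 [X in _ + X = _]mulrC; exact: addIr.
have := sparse_eval_area w r1 r2 r3 s1 s2 s3; rewrite areaw => sparse0.
have [/and4P[]|not_const] := boolP [&& (r1 + s2 == r2 + s3 %[mod k])%N,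
    (r2 + s3 == r3 + s1 %[mod k])%N, (r2 + s1 == r3 + s2 %[mod k])%N
  & (r3 + s2 == r1 + s3 %[mod k])%N].
  rewrite -!(eq_prim_root_expr prim_w) !exprD => /eqP c1 /eqP c2 /eqP c3 /eqP c4.
  have [||/eqP] := cyclic_ratio_char3 _ c1 c2 c3 c4 areaw.
  - by rewrite !expf_neq0.
  - by move=> /(ratio _ _ _ _ E1 E2)/eqP; apply/negP.
  - exact/negP.
have [|z prim_z sparse_z0] := lift_vanishing_sum k_gt1 charKp prim_w co_kp _ p_large sparse0.
  exact: energy_area_le14.
have z0 := prim_root_neq0 prim_z.
have area_z0 := sparse_z0; rewrite sparse_eval_area in area_z0.
(* Conjugation inverts z, so the area of the inverses vanishes as well. *)
have := conjC_sparse_eval area_sign (area_exponent r1 r2 r3 s1 s2 s3) z.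
rewrite sparse_z0 rmorph0 (conjC_prim_root prim_z) sparse_eval_area !exprVn.
move=> /esym/(collinear_with_inverses _ area_z0).
rewrite !expf_neq0 // -!exprD !(eq_prim_root_expr prim_z) => /(_ isT).
rewrite -!(eq_prim_root_expr prim_w) (negbTE u12) (negbTE v13) /= !exprD.
by move=> /eqP/(ratio _ _ _ _ E2 E3)/eqP; apply/negP.
Qed.

Lemma prim_root_primitive_element (F : finFieldType) (g : {unit F}) :
  primitive_element g -> #|F|.-1.-primitive_root (FinRing.uval g).
Proof.
move=> /eqP gen_g; have val_exp i : FinRing.uval (g ^+ i)%g = FinRing.uval g ^+ i.
  by elim: i => // i IHi; rewrite expgS exprS -IHi.
have ord_g : #[g]%g = #|F|.-1 by rewrite -card_finField_unit gen_g.
have [|m prim_m m_dvd] := @prim_order_exists F _ (FinRing.uval g) (order_gt0 g).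
  by rewrite -val_exp expg_order.
rewrite -ord_g; suff -> : #[g]%g = m by [].
apply/eqP; rewrite eqn_dvd m_dvd andbT order_dvdn; apply/eqP/val_inj.
by rewrite /= val_exp (prim_expr_order prim_m).
Qed.

Lemma cyclotomic_class_exp (F : finFieldType) (g : {unit F}) (e k a : nat) (x : F) :
  x \in cyclotomic_class g e k a%:Z ->
  exists r : nat, x = FinRing.uval g ^+ a * (FinRing.uval g ^+ e) ^+ r.
Proof.
case/imsetP=> r _ ->; exists r.
by rewrite -PoszM -PoszD -exprnP exprD mulnC exprM.
Qed.

Theorem theorem5p6 (R : realType) (p n q e k : nat) (F : finFieldType)
    (g : {unit F}) (a b : nat)
    (p_prime : prime p) (n_gt0 : (0 < n)%N) (q_def : q = (p ^ n)%N)
    (cardF : #|F| = q) (g_prim : primitive_element g)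
    (e_div : nontrivial_divisor e (q - 1)%N)
    (k_div : nontrivial_divisor k (q - 1)%N)
    (q_ek : q = (e * k + 1)%N)
    (a_range : (1 <= a <= e - 1)%N) (b_range : (1 <= b <= e - 1)%N)
    (a_neq_b : a <> b)
    (p_large : p%:R > ((14%:R * k%:R) / (totient k)%:R : R)
                        `^ ((totient k)%:R / (2%:R * (ord_mod k p)%:R))) :
  (cyclotomic_number g e k a%:Z b%:Z <= 2)%N.
Proof.
have q_gt1 : (1 < q)%N by rewrite q_def -(expn0 p) ltn_exp2l // prime_gt1.
have k_gt0 : (0 < k)%N by rewrite lt0n; apply: contraTneq q_gt1 => k0; rewrite q_ek k0 muln0.
have k_gt1 : (1 < k)%N by rewrite ltn_neqAle k_gt0 eq_sym andbT; case/and3P: k_div.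
have charFp : p \in [pchar F].
  by apply: (card_finPcharP (n := n)); rewrite // cardF.
have prim_w : k.-primitive_root (FinRing.uval g ^+ e).
  have q1 : #|F|.-1 = (e * k)%N by rewrite cardF q_ek addn1.
  have := dvdn_prim_root (prim_root_primitive_element g_prim) (_ : k %| _)%N.
  by rewrite q1 mulnK // dvdn_mull // => /(_ isT).
have co_kp : coprime k p.
  have : coprime (e * k) (p ^ n) by rewrite -q_def q_ek addn1 coprimenS.
  by rewrite coprimeMl => /andP[_]; rewrite coprime_pexpr.
have m_gt0 : (0 < totient k)%N by rewrite totient_gt0.
have {}p_large := powR_bound_nat (order_gt0 _) m_gt0 p_large.
have g0 i : FinRing.uval g ^+ i != 0.
  by rewrite expf_neq0 // -unitfE (valP g).
rewrite leqNgt; apply/negP => /card_gt2P[[x1 y1] [[x2 y2] [[x3 y3]]]].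
rewrite !inE /= => -[[/and3P[X1 Y1 /eqP E1] /and3P[X2 Y2 /eqP E2] /and3P[X3 Y3 /eqP E3]]].
rewrite -{}E1 -{}E2 -{}E3 in Y1 Y2 Y3 *.
have [r1 Er1] := cyclotomic_class_exp X1; have [s1 Es1] := cyclotomic_class_exp Y1.
have [r2 Er2] := cyclotomic_class_exp X2; have [s2 Es2] := cyclotomic_class_exp Y2.
have [r3 Er3] := cyclotomic_class_exp X3; have [s3 Es3] := cyclotomic_class_exp Y3.
rewrite !xpair_eqE !(inj_eq (addrI 1)) !andbb.
move: Es1 Es2 Es3; rewrite {}Er1 {}Er2 {}Er3 !(inj_eq (mulfI (g0 a))) => E1 E2 E3.
case=> u12 u23 u31.
have := no_three_shifted_roots k_gt1 charFp co_kp prim_w p_large (g0 a) (g0 b) E1 E2 E3.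
by rewrite (negbTE u12) (negbTE u23) eq_sym (negbTE u31).
Qed.
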